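(* Let $d\geq k\geq 1$ be integers, and let $\mathcal{H}$ be a $d$-regular $3$-uniform hypergraph. Then there is a spanning subhypergraph $\mathcal{C}\subseteq \mathcal{H}$ such that $\deg_{\mathcal{C}} v\in \{k, k+1, k+2\}$ for all $v\in V(\mathcal{H})$.
   Context: A hypergraph $\mathcal{H}$ consists of a finite vertex set $V(\mathcal{H})$ and a set $E(\mathcal{H})$ of subsets of $V(\mathcal{H})$, called edges. It is $r$-uniform if every edge has exactly $r$ vertices. The degree $\deg_{\mathcal{H}} v$ of a vertex $v$ is the number of edges containing $v$; $\mathcal{H}$ is $d$-regular if every vertex has degree $d$. A spanning subhypergraph $\mathcal{C}\subseteq\mathcal{H}$ is a hypergraph with $V(\mathcal{C})=V(\mathcal{H})$ and $E(\mathcal{C})\subseteq E(\mathcal{H})$. *)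

(* Defs.v *)
From mathcomp Require Import all_boot.

Set Implicit Arguments.
Unset Strict Implicit.
Unset Printing Implicit Defensive.

(* The vertex set is the whole finite type [V], so a hypergraph on [V] is given
   by its edge set, and all hypergraphs on [V] share the same vertex set. *)
Definition hypergraph (V : finType) := {set {set V}}.

Definition uniform (V : finType) (r : nat) (H : hypergraph V) : Prop :=
  forall e : {set V}, e \in H -> #|e| = r.

Definition deg (V : finType) (H : hypergraph V) (v : V) : nat :=
  #|[set e in H | v \in e]|.

Definition regular (V : finType) (d : nat) (H : hypergraph V) : Prop :=
  forall v : V, deg H v = d.

Definition spanning_subhypergraph (V : finType) (C H : hypergraph V) : Prop :=
  C \subset H.

(* Main.v *)
(* If d <= k + 1 take C = H; otherwise give every edge the weight (k+1)/d, so
   that every vertex has weighted degree k + 1, and round the weights to 0 or 1.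
   Call an edge fractional while its weight lies strictly between 0 and 1.
   The constraint "weighted degree = k + 1" at a vertex meeting at most two
   fractional edges may be dropped: whichever way they are rounded, the degree
   ends up in [k, k+2].  If the remaining linear system has a nonzero kernel
   vector, moving along it makes a further edge integral.  Otherwise some maximal
   minor is nonzero, and a nonzero term of its Leibniz expansion matches the
   fractional edges injectively to incident constrained vertices.  Each such
   vertex meets at least three fractional edges and each edge has only three
   vertices, so by double counting the matching is onto and every constrained
   vertex meets exactly three fractional edges.  Its error then exceeds 1 only if
   all three are rounded in one particular direction, which its matched edge
   prevents. *)
Require Import Defs.
From mathcomp Require Import all_boot.
From mathcomp Require Import all_order all_algebra all_fingroup.
From mathcomp Require Import lra zify.

Set Implicit Arguments.
Unset Strict Implicit.
Unset Printing Implicit Defensive.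

Import Order.TTheory GRing.Theory Num.Theory.

Lemma kernel_or_matching (K : fieldType) (A B : finType) (a : A -> B -> K)
    (W : {set A}) (S : {set B}) :
  (exists2 y : B -> K, (exists2 b, b \in S & y b != 0%R) &
     forall w, w \in W -> (\sum_(b in S) a w b * y b = 0)%R) \/
  (exists2 g : 'I_#|S| -> A, injective g &
     forall i, g i \in W /\ a (g i) (enum_val i) != 0%R).
Proof.
pose M : 'M[K]_(#|W|, #|S|) := (\matrix_(i, j) a (enum_val i) (enum_val j))%R.
case: (boolP (row_full M)) => [fullM|nfullM]; [right | left].
  pose f := fullrankfun fullM.
  have : (\det (rowsub f M) != 0)%R.
    by rewrite -unitfE -[_ \is a _]unitmxE -row_full_unit fullrowsub_full.
  have [s hs _|no_s] :=
      pickP (fun s : 'S_#|S| => [forall i, rowsub f M i (s i) != 0%R]).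
    (* The nonzero term pairs row [i] of the minor with column [s i]; inverting [s] assigns a row to
       each column. *)
    exists (fun i => enum_val (f ((s^-1)%g i))).
      by move=> i j /enum_val_inj/fullrankfun_inj/perm_inj.
    move=> i; split; first exact: enum_valP.
    by move/forallP: hs => /(_ ((s^-1)%g i)); rewrite permKV !mxE.
  case/eqP; rewrite /determinant big1 // => s _.
  have /negbT/forallPn[i] := no_s s; rewrite negbK => /eqP si0.
  by rewrite (bigD1 i) //= si0 mul0r mulr0.
have /matrix0Pn[i [j cij]] : cokermx M != 0%R by rewrite cokermx_eq0.
(* Column [j] of the cokernel, carried over to [B]: the sum has one term on [S] and none
   elsewhere. *)
pose y b := (\sum_(l | enum_val l == b) cokermx M l j)%R.
have yE l : y (enum_val l) = cokermx M l j.
  by rewrite /y (big_pred1 l) // => m; rewrite (inj_eq enum_val_inj).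
exists y; first by exists (enum_val i); rewrite ?yE ?enum_valP.
move=> w wW; have /matrixP/(_ (enum_rank_in wW w) j) := mulmx_coker M.
rewrite mxE [RHS]mxE => coker0; apply: etrans coker0.
rewrite big_enum_val; apply: eq_bigr => l _.
by rewrite yE [M _ _]mxE enum_rankK_in.
Qed.

Section Degrees.
Variable V : finType.
Implicit Types (I F C : hypergraph V) (v : V).

Lemma degS C F v : C \subset F -> deg C v <= deg F v.
Proof.
move=> /subsetP sCF; apply/subset_leq_card/subsetP => e.
by rewrite !inE => /andP[/sCF-> ->].
Qed.

Lemma degU I F v : [disjoint I & F] -> deg (I :|: F) v = deg I v + deg F v.
Proof.
move=> dIF; rewrite /deg -cardsUI.
rewrite (_ : _ :&: _ = set0) ?cards0 ?addn0.
  by apply: eq_card => e; rewrite !inE andb_orl.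
apply/setP => e; rewrite !inE andbACA.
have := disjoint_setI0 dIF; move/setP/(_ e); rewrite !inE.
by case: (_ \in I); case: (_ \in F).
Qed.

Lemma deg_gt0 F v : reflect (exists2 e, e \in F & v \in e) (0 < deg F v).
Proof.
apply: (iffP card_gt0P) => [[e]|[e eF ve]]; last by exists e; rewrite !inE eF.
by rewrite !inE => /andP[]; exists e.
Qed.

Lemma sum_const_deg (R : pzSemiRingType) F v (c : R) :
  (\sum_(e in F | v \in e) c = c *+ deg F v)%R.
Proof.
by rewrite sumr_const; congr (_ *+ _)%R; apply: eq_card => e; rewrite !inE.
Qed.

Lemma sum_deg F (W : {set V}) :
  \sum_(v in W) deg F v = \sum_(e in F) #|e :&: W|.
Proof.
under eq_bigr => v _ do rewrite /deg -sum1_card.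
rewrite (exchange_big_dep (mem F)) /=; last by move=> v e _; rewrite !inE => /andP[].
apply: eq_bigr => e eF; rewrite -sum1_card; apply: eq_bigl => v.
by rewrite !inE eF andbC.
Qed.

(* An edge of [I] has value 1, an edge of [F] a value strictly between 0 and 1,
   and [W] is the set of vertices whose degree constraint is still enforced. *)
Definition fractional k I F (W : {set V}) (x : {set V} -> rat) : Prop :=
  [/\ [disjoint I & F],
      forall e, e \in F -> (0 < x e < 1)%R,
      forall v, v \in W ->
        ((deg I v)%:R + \sum_(e in F | v \in e) x e = k.+1%:R)%R
    & forall v, v \notin W -> k <= deg I v /\ deg I v + deg F v <= k.+2].

(** The fractional edges at [v], if any, have a total weight strictly between 0 and [deg F v], and
    the constraint makes this total [k + 1 - deg I v]. *)
Lemma fractional_deg k I F W x v :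
  fractional k I F W x -> v \in W ->
  [/\ deg I v <= k.+1, k.+1 <= deg I v + deg F v
    & 0 < deg F v -> deg I v < k.+1 < deg I v + deg F v].
Proof.
case=> _ x01 sumx _ vW; have := sumx v vW.
have [F0|/[dup] F0 /deg_gt0[e eF ve]] := posnP (deg F v).
  rewrite F0 big_pred0 ?addr0; last first.
    move=> e; apply/negP => /andP[eF ve].
    suff: 0 < deg F v by rewrite F0.
    by apply/deg_gt0; exists e.
  by move/eqP; rewrite eqr_nat => /eqP->; rewrite addn0.
have s0 : (0 < \sum_(e in F | v \in e) x e)%R.
  rewrite (bigD1 e) ?eF //= ltr_wpDr ?sumr_ge0 //.
    by move=> i /andP[/andP[/x01/andP[/ltW]]].
  by have /andP[] := x01 e eF.
have s1 : (\sum_(e in F | v \in e) x e < (deg F v)%:R)%R.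
  rewrite -sum_const_deg (bigD1 e) ?eF //= [ltRHS](bigD1 e) ?eF //=.
  rewrite ltr_leD ?ler_sum //; first by have /andP[] := x01 e eF.
  by move=> i /andP[/andP[/x01/andP[_ /ltW]]].
move=> E.
have lt1 : deg I v < k.+1 by rewrite -(ltr_nat rat) -E; lra.
have lt2 : k.+1 < deg I v + deg F v by rewrite -(ltr_nat rat) -E natrD; lra.
by split; rewrite ?lt1 ?lt2 // ltnW.
Qed.

(* The largest step along [y] that keeps [x] in the unit cube. *)
Lemma boundary_step (T : finType) (F : {set T}) (x y : T -> rat) :
  (forall e, e \in F -> (0 < x e < 1)%R) ->
  (exists2 e, e \in F & y e != 0%R) ->
  exists t : rat,
    (forall e, e \in F -> (0 <= x e + t * y e <= 1)%R) /\
    exists2 e, e \in F & ~~ (0 < x e + t * y e < 1)%R.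
Proof.
move=> x01 [e0 e0F ye0].
(* The step at which coordinate [e] reaches the bound it moves towards: 1 if [y e] is positive, 0 if
   negative. *)
pose room e := ((if (0 < y e)%R then 1 - x e else - x e) / y e)%R.
have [|e /andP[eF ye] emin] :=
    @arg_minP _ _ _ e0 [pred e in F | y e != 0%R] room; first by rewrite inE e0F.
have room_gt0 i : i \in F -> y i != 0%R -> (0 < room i)%R.
  move=> /x01/andP[xi0 xi1] yi; rewrite /room; case: (ltgtP 0%R (y i)) yi => // yi _.
    by rewrite divr_gt0 // subr_gt0.
  by rewrite -mulrNN -invrN divr_gt0 ?opprK ?oppr_gt0.
have t0 := room_gt0 e eF ye.
exists (room e); split=> [i iF|].
  have /andP[xi0 xi1] := x01 i iF.
  have [->|yi] := eqVneq (y i) 0%R; first by rewrite mulr0 addr0 !ltW.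
  have := emin i; rewrite inE iF yi => /(_ isT).
  move: (room e) t0 => t t0; rewrite /room.
  case: (ltgtP 0%R (y i)) yi => // yi _.
    rewrite ler_pdivlMr // => le; have := mulr_gt0 t0 yi; lra.
  rewrite ler_ndivlMr // => le; have : (t * y i < 0)%R by rewrite pmulr_rlt0.
  lra.
exists e => //; rewrite /room divfK //.
by case: ifP => _; rewrite addrC ?subrK ?addNr ltxx ?andbF.
Qed.

(** Moving along [y] preserves the weighted degrees on [W]. Edges reaching weight 1 join [I], and
    those reaching 0 are discarded. *)
Lemma fractional_reduce k I F W x (y : {set V} -> rat) :
  fractional k I F W x -> (exists2 e, e \in F & y e != 0%R) ->
  (forall w, w \in W -> (\sum_(e in F) (w \in e)%:R * y e = 0)%R) ->
  exists I' F' z, [/\ fractional k I' F' W z, F' \proper F, I \subset I'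
    & I' :|: F' \subset I :|: F].
Proof.
move=> [dIF x01 sumx dropped] ynz ker.
have [t [z01 [e eF ze]]] := boundary_step x01 ynz.
pose z e := (x e + t * y e)%R.
pose G := [set e in F | z e == 1%R]; pose F' := [set e in F | (0 < z e < 1)%R].
have dIG : [disjoint I & G].
  by apply: disjointWr dIF; apply/subsetP => i; rewrite !inE => /andP[].
have dGF : [disjoint G & F'].
  rewrite -setI_eq0; apply/eqP/setP => i; rewrite !inE.
  by case: eqP => [->|]; rewrite ?ltxx !andbF.
have dIF' : [disjoint I & F'].
  by apply: disjointWr dIF; apply/subsetP => i; rewrite !inE => /andP[].
have sGF : G :|: F' \subset F.
  by apply/subsetP => i; rewrite !inE -andb_orr => /andP[].
exists (I :|: G), F', z; split.
- split.
  + by rewrite -setI_eq0 setIUl setU_eq0 !setI_eq0 dIF' dGF.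
  + by move=> i; rewrite inE => /andP[].
  + move=> w wW; rewrite -(sumx w wW) degU // natrD -addrA; congr (_ + _)%R.
    have -> : (\sum_(e in F | w \in e) x e = \sum_(e in F | w \in e) z e)%R.
      rewrite big_split /= -mulr_sumr -[LHS]addr0; congr (_ + _)%R.
      rewrite (_ : \sum_(e in F | w \in e) y e = 0)%R ?mulr0 //.
      apply: etrans (ker w wW); rewrite big_mkcondr.
      by apply: eq_bigr => i _; rewrite mulr_natl mulrb.
    rewrite -[(deg G w)%:R%R]sum_const_deg.
    rewrite [RHS](bigID (fun i => i \in G)) /=; congr (_ + _)%R.
      apply: eq_big => [i|i]; rewrite !inE; last by case/andP=> /andP[_ /eqP].
      by case: (i \in F); case: (w \in i); rewrite ?andbT ?andbF.
    (* Edges of [F] in neither [G] nor [F'] have new weight 0. *)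
    rewrite [RHS](bigID (fun i => i \in F')) /= [X in (_ + X)%R]big1 ?addr0.
      apply: eq_bigl => i; rewrite !inE; case: (i \in F); rewrite //=.
      by case: eqP => [->|_]; rewrite ?ltxx ?andbF ?andbT // andbC.
    move=> i; rewrite !inE => /andP[/andP[/andP[iF _]]].
    rewrite iF /=; have := z01 i iF; rewrite -/(z i) !le_eqVlt.
    by case/andP=> /orP[/eqP<-//|->] /orP[->|->].
  + move=> v vW; have [k1 k2] := dropped v vW; rewrite degU //; split; first lia.
    by have := degS v sGF; rewrite degU //; lia.
- rewrite properE; apply/andP; split.
    by apply: subset_trans sGF; apply: subsetUr.
  by apply/subsetPn; exists e => //; rewrite !inE eF.
- exact: subsetUl.
- by rewrite -setUA setUS.
Qed.

(* A constrained vertex has deg I v equal to k or k - 1; its matched edge is left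
   out in the first case and taken in the second. *)
Lemma round_matching k I F W x (g : 'I_#|F| -> V) :
  fractional k I F W x -> (forall e, e \in F -> #|e| <= 3) ->
  (forall v, v \in W -> 2 < deg F v) ->
  injective g -> (forall i, g i \in W /\ g i \in enum_val i) ->
  exists C, [/\ I \subset C, C \subset I :|: F
    & forall v, k <= deg C v <= k.+2].
Proof.
move=> frac F3 W3 ginj gP; have [dIF _ _ dropped] := frac.
have sgW : g @: setT \subset W.
  by apply/subsetP => _ /imsetP[i _ ->]; have [] := gP i.
have cardg : #|g @: setT| = #|F| by rewrite card_imset // cardsT card_ord.
have leFW : #|F| <= #|W| by rewrite -cardg subset_leq_card.
(* Counted by edges, the incidences number at most [3 * #|F|], hence at most [3 * #|W|]; this leaves
   no slack in the lower bound 3 on each degree. *)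
have sumle : \sum_(v in W) deg F v <= \sum_(v in W) 3.
  rewrite sum_deg sum_nat_const (@leq_trans (#|F| * 3)) ?leq_mul2r ?leFW //.
  rewrite -sum_nat_const; apply: leq_sum => e /F3; apply: leq_trans.
  exact/subset_leq_card/subsetIl.
have degW v : v \in W -> deg F v = 3.
  have le3 w : w \in W -> 3 <= deg F w ?= iff (3 == deg F w).
    by move=> /W3 le; split.
  have [le eq] := leqif_sum le3.
  move: eq; rewrite eqn_leq le sumle => /esym/forall_inP all3 /all3.
  by move/eqP.
have leWF : #|W| <= #|F|.
  rewrite -(leq_pmul2r (isT : 0 < 3)) -!sum_nat_const.
  rewrite -(eq_bigr _ degW) sum_deg; apply: leq_sum => e /F3.
  exact/leq_trans/subset_leq_card/subsetIl.
have gW : g @: setT = W by apply/eqP; rewrite eqEcard sgW cardg.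
pose G := [set enum_val i | i in [pred i : 'I_#|F| | deg I (g i) < k]].
have sGF : G \subset F by apply/subsetP => _ /imsetP[i _ ->]; apply: enum_valP.
have dIG : [disjoint I & G] := disjointWr sGF dIF.
exists (I :|: G); split; [exact: subsetUl | exact: setUS |].
move=> v; rewrite degU //; have leGF := degS v sGF.
have [vW|/dropped] := boolP (v \in W); last lia.
have [_ _] := fractional_deg frac vW; rewrite degW // in leGF * => /(_ isT) b.
move: (vW); rewrite -gW => /imsetP[i _ vE].
have ve : v \in enum_val i by rewrite vE; have [] := gP i.
(* Three fractional edges remain at [v]: from [k - 1] only taking none fails, from [k] only taking
   all three. *)
have [ltk|gek] := ltnP (deg I v) k.
  suff: 0 < deg G v by lia.
  apply/deg_gt0; exists (enum_val i) => //.
  by apply: imset_f; rewrite inE -vE.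
suff: deg G v < deg F v by rewrite degW //; lia.
apply/proper_card/properP; split.
  by apply/subsetP => e; rewrite !inE => /andP[/(subsetP sGF)-> ->].
exists (enum_val i); first by rewrite inE enum_valP.
rewrite inE negb_and; apply/orP; left; apply/imsetP => -[j].
by rewrite inE => ltk /enum_val_inj ij; move: ltk; rewrite -ij -vE; lia.
Qed.

(** Each descent step drops a constraint, shrinking [W], or follows a kernel vector, shrinking [F];
    a matching ends it. *)
Lemma round_fractional k I F W x :
  fractional k I F W x -> (forall e, e \in F -> #|e| <= 3) ->
  exists C, [/\ I \subset C, C \subset I :|: F
    & forall v, k <= deg C v <= k.+2].
Proof.
have [n] := ubnP (#|F| + #|W|).
elim: n => // n IHn in I F W x * => lt_n frac F3.
have [v /andP[vW v2]|W3] := pickP [pred v in W | deg F v <= 2].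
  apply: (IHn I F (W :\ v) x) => //; first by rewrite (cardsD1 v W) vW in lt_n; lia.
  have [dIF x01 sumx dropped] := frac; split=> // u.
    by rewrite !inE => /andP[_ /sumx].
  rewrite !inE negb_and negbK => /orP[/eqP->|/dropped //].
  (* With one or two fractional edges at [v], the strict bounds force [deg I v = k]; with none,
     [deg I v = k + 1]. *)
  have [b1 b2 b3] := fractional_deg frac vW.
  by have [F0|/b3] := posnP (deg F v); lia.
have [[y ynz ker]|[g ginj gP]] :=
    kernel_or_matching (fun (v : V) (e : {set V}) => ((v \in e)%:R : rat)%R) W F.
  have [I' [F' [z [frac' ltF sI sU]]]] := fractional_reduce frac ynz ker.
  have [||C [sC1 sC2 Cdeg]] := IHn I' F' W z _ frac'.
  - by have := proper_card ltF; lia.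
  - by move=> e /(subsetP (proper_sub ltF))/F3.
  by exists C; split=> //; [apply: subset_trans sC1 | apply: subset_trans sU].
apply: (round_matching frac F3 _ ginj) => [v vW|i].
  by have := W3 v; rewrite /= vW /= ltnNge => ->.
by have [giW] := gP i; rewrite pnatr_eq0 eqb0 negbK.
Qed.

End Degrees.

Theorem theorem1p3 (V : finType) (H : hypergraph V) (d k : nat)
    (hk : 1 <= k) (hkd : k <= d)
    (hreg : regular d H) (hunif : uniform 3 H) :
  exists C : hypergraph V,
    spanning_subhypergraph C H /\
    forall v : V, deg C v \in [:: k; k.+1; k.+2].
Proof.
have [lekd|ltkd] := leqP d k.+1.
  by exists H; split=> [|v]; rewrite ?/spanning_subhypergraph // hreg !inE; lia.
pose x (_ : {set V}) : rat := (k.+1%:R / d%:R)%R.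
have d0 : (0 < d%:R :> rat)%R by rewrite ltr0n; lia.
(* Initially every edge is fractional, as [k + 1 < d], and every vertex is constrained. *)
have [||C [_ sC Cdeg]] := @round_fractional V k set0 H setT x.
- split=> [|e _|v _|v]; last by rewrite inE.
  + by rewrite -setI_eq0 set0I.
  + by rewrite /x ltr_pdivrMr // mul1r ltr_nat ltkd andbT divr_gt0 // ltr0n.
  + rewrite sum_const_deg hreg -[(_ *+ d)%R]mulr_natr /x divfK ?gt_eqF //.
    by rewrite [deg _ _](_ : _ = 0) ?add0r //; apply: eq_card0 => e; rewrite !inE.
- by move=> e /hunif->.
exists C; split=> [|v]; first by rewrite set0U in sC.
by have := Cdeg v; rewrite !inE; lia.
Qed.
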